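(* For all positive integers $n,m$ and every integer $1\le k<m$, the bounded-error quantum query complexity of $h_{k,n,m}$ satisfies $Q(h_{k,n,m})=\tilde O\!\left(\sqrt{nm/k}+\sqrt{kn}+k+\sqrt m\right)$.
   Context: Let $n,m$ be positive integers, $1\le k<m$ an integer, $M=[n]\times[m]$ (a grid of cells with $n$ rows and $m$ columns), $\tilde M=M\cup\{\bot\}$ (pointers to cells, $\bot$ the null pointer). Let $T$ be the following fixed binary tree with $m$ leaves and $m-1$ internal nodes: if $m=2^r$, $T$ is the complete binary tree with $2^r$ leaves; if $2^r<m<2^{r+1}$, take the complete binary tree with $2^r$ leaves and add a pair of children to each of its $m-2^r$ leftmost leaves. Outgoing arcs are labeled 'left'/'right', leaves labeled $1,\dots,m$ from left to right, and $T(j)$ is the sequence of labels on the root-to-leaf-$j$ path. The alphabet is $\Sigma=\{0,1\}\times\tilde M\times\tilde M\times\tilde M$ with components $\mathrm{val},\mathrm{lpoint},\mathrm{rpoint},\mathrm{ipoint}$. The function $h_{k,n,m}\colon\Sigma^M\to\{0,1\}$ has $h_{k,n,m}(x)=1$ iff: (1) there are exactly $k$ columns $b_1,\dots,b_k$ with $\mathrm{val}(x_{i,b_s})=1$ for all $i\in[n]$, $s\in[k]$ (marked columns); (2) each marked column $b_s$ contains a unique cell $a_s$ with $x_{a_s}\ne(1,\bot,\bot,\bot)$ (special elements); (3) $\mathrm{ipoint}(x_{a_s})=a_{s+1}$ for $s\in[k-1]$, $\mathrm{ipoint}(x_{a_k})=a_1$, and $\mathrm{lpoint}(x_{a_s})=\mathrm{lpoint}(x_{a_t})$,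 $\mathrm{rpoint}(x_{a_s})=\mathrm{rpoint}(x_{a_t})$ for all $s,t\in[k]$; (4) for each non-marked column $j$, the path starting at a special element and following $\mathrm{lpoint},\mathrm{rpoint}$ as specified by $T(j)$ exists (no $\bot$ on it) and ends at a cell $\ell_j$ in column $j$ with $\mathrm{val}(x_{\ell_j})=0$. $Q(f)$ is the minimum number of queries of a quantum query algorithm (queries $O_x|c,p\rangle|w\rangle=|c,p+x_c\bmod|\Sigma|\rangle|w\rangle$, $\Sigma$ identified with $[|\Sigma|]$) outputting $f(x)$ with probability at least $9/10$ on every input. $\tilde O$ hides factors polylogarithmic in $n,m$. *)

(* Defs.v *)
From HB Require Import structures.
From mathcomp Require Import all_boot all_order all_algebra.
From mathcomp Require Import reals Rstruct.
From mathcomp Require Import complex.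


Set Implicit Arguments.
Unset Strict Implicit.
Unset Printing Implicit Defensive.

Import Order.TTheory GRing.Theory Num.Theory.
Local Open Scope ring_scope.

Notation RR := Rdefinitions.R.
Notation Cplx := (RR[i]).

(* M = [n] x [m] (0-indexed: row i : 'I_n, column j : 'I_m) *)
Definition cell (n m : nat) := ('I_n * 'I_m)%type.

(* Sigma = {0,1} x M~ x M~ x M~, with M~ = option M (None = bottom) *)
Definition Sigma (n m : nat) :=
  (bool * option (cell n m) * option (cell n m) * option (cell n m))%type.

Definition sval {n m} (s : Sigma n m) : bool := s.1.1.1.
Definition lpoint {n m} (s : Sigma n m) : option (cell n m) := s.1.1.2.
Definition rpoint {n m} (s : Sigma n m) : option (cell n m) := s.1.2.
Definition ipoint {n m} (s : Sigma n m) : option (cell n m) := s.2.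

Definition blank {n m} : Sigma n m := (true, None, None, None).

Definition input (n m : nat) := {ffun cell n m -> Sigma n m}.

Inductive btree := Leaf | Node of btree & btree.

Fixpoint complete (r : nat) : btree :=
  if r is r'.+1 then Node (complete r') (complete r') else Leaf.

(* give a pair of children to the t leftmost leaves; returns the new tree
   and the number of leaves still to be expanded *)
Fixpoint grow (t : btree) (c : nat) : btree * nat :=
  match t with
  | Leaf => if c is c'.+1 then (Node Leaf Leaf, c') else (Leaf, 0%N)
  | Node l r =>
      let (l', c1) := grow l c in
      let (r', c2) := grow r c1 in (Node l' r', c2)
  end.

Definition treeT (m : nat) : btree :=
  let r := trunc_log 2 m in (grow (complete r) (m - 2 ^ r)).1.

Fixpoint leaf_paths (t : btree) : seq (seq bool) :=
  match t with
  | Leaf => [:: [::]]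
  | Node l r => map (cons false) (leaf_paths l) ++ map (cons true) (leaf_paths r)
  end.

(* T(j) for column j (column j : 'I_m is leaf number j+1) *)
Definition Tpath (m : nat) (j : 'I_m) : seq bool := nth [::] (leaf_paths (treeT m)) j.
Arguments Tpath : clear implicits.

Definition follow {n m} (x : input n m) (c : cell n m) (p : seq bool) : option (cell n m) :=
  foldl (fun oc (d : bool) =>
           obind (fun c' => if d then rpoint (x c') else lpoint (x c')) oc)
        (Some c) p.

Definition marked {n m} (x : input n m) (j : 'I_m) : Prop :=
  forall i : 'I_n, sval (x (i, j)) = true.

(* b s = marked column b_{s+1}, a s = row of the special element a_{s+1} *)
Definition h_pred (k n m : nat) (x : input n m) : Prop :=
  exists (b : 'I_k -> 'I_m) (a : 'I_k -> 'I_n),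
    injective b /\
    (forall j : 'I_m, marked x j <-> exists s, j = b s) /\
    (forall s : 'I_k, x (a s, b s) <> blank /\
        forall i : 'I_n, i <> a s -> x (i, b s) = blank) /\
    (forall s : 'I_k, ipoint (x (a s, b s)) = Some (a (ordS s), b (ordS s))) /\
    (forall s t : 'I_k, lpoint (x (a s, b s)) = lpoint (x (a t, b t)) /\
                        rpoint (x (a s, b s)) = rpoint (x (a t, b t))) /\
    (forall j : 'I_m, ~ marked x j ->
       forall s : 'I_k, exists l : cell n m,
         follow x (a s, b s) (Tpath m j) = Some l /\ l.2 = j /\ sval (x l) = false).

Definition cconj (z : Cplx) : Cplx := let: Complex a b := z in Complex a (- b).
Definition sqnorm (z : Cplx) : RR := let: Complex a b := z in a ^+ 2 + b ^+ 2.

(* computational basis |c, p>|w> : query register (c in M, p in [|Sigma|])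
   and workspace w in 'I_d *)
Definition basis (n m d : nat) := (cell n m * 'I_#|{: Sigma n m}| * 'I_d)%type.

Definition mat (B : finType) := B -> B -> Cplx.
Definition vect (B : finType) := B -> Cplx.

Definition mapply {B : finType} (U : mat B) (v : vect B) : vect B :=
  fun b => \sum_(b' : B) U b b' * v b'.

Definition unitary {B : finType} (U : mat B) : Prop :=
  forall b b' : B, \sum_(c : B) cconj (U c b) * U c b' = (b == b')%:R.

Definition ket {B : finType} (b0 : B) : vect B := fun b => (b == b0)%:R.

Definition query_map {n m d} (x : input n m) (z : basis n m d) : basis n m d :=
  let: (c, p, w) := z in
  (c, insubd p ((p + enum_rank (x c)) %% #|{: Sigma n m}|)%N, w).

Definition oracle {n m d} (x : input n m) : mat (basis n m d) :=
  fun b' b => (b' == query_map x b)%:R.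

Fixpoint qstate {n m d} (x : input n m) (U : nat -> mat (basis n m d))
    (b0 : basis n m d) (i : nat) : vect (basis n m d) :=
  match i with
  | 0 => mapply (U 0%N) (ket b0)
  | i'.+1 => mapply (U i) (mapply (oracle x) (qstate x U b0 i'))
  end.

Definition prob_out {B : finType} (psi : vect B) (out : B -> bool) (o : bool) : RR :=
  \sum_(z : B | out z == o) sqnorm (psi z).

Arguments h_pred : clear implicits.

Definition computes_with {n m} (P : input n m -> Prop) (T : nat) : Prop :=
  exists (d : nat) (U : nat -> mat (basis n m d)) (b0 : basis n m d)
         (out : basis n m d -> bool),
    (forall i, (i <= T)%N -> unitary (U i)) /\
    forall x : input n m,
      (P x -> prob_out (qstate x U b0 T) out true >= 9 / 10) /\
      (~ P x -> prob_out (qstate x U b0 T) out false >= 9 / 10).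

Definition Q_le {n m} (P : input n m -> Prop) (t : nat) : Prop :=
  exists T, (T <= t)%N /\ computes_with P T.

(* Main.v *)
(* No algorithm is written down: a feasible solution of the dual adversary program is
   exhibited, and any such solution of value W yields an algorithm with O(W) queries.

   For the conversion, let p, q be the solution, with query positions c_i, and put
   zeta_x = sum_i p_i(x) |c_i> (|0>|false> + |-x_(c_i)>|true>) / sqrt 2 on positive inputs,
   and the same with q_i and a minus sign between the two halves on negative ones.
   Feasibility says exactly that the states
     sqrt ((T - t) / T) |start> + sqrt (t / T) |h(x)> + zeta_x / sqrt T
   have, after one query, the Gram matrix of the states at time t + 1; hence a unitary that
   does not depend on x carries out every step, and the only error, of squared norm W / T,
   is made by starting from |start>.

   For h, let x be positive and y negative, and write 1 = (1 - S0) + (S0 - S1) + S1, where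
   S0 is the overlap of the uniform superpositions of marked columns (damped when there are
   more than k of them) and S1 that of the superpositions of their nonblank cells.
   The first two terms cost sqrt (nm/k) and sqrt n. For the third, given one special cell,
   follow ipoint k times, then search the kn cells of the marked columns for a nonblank one
   and the m columns for a tree path that fails. *)
Require Import Defs.
From HB Require Import structures.
From mathcomp Require Import all_boot all_order all_algebra.
From mathcomp Require Import boolp reals Rstruct.
From mathcomp Require Import complex.
From mathcomp Require Import ring lra.
Import Order.TTheory GRing.Theory Num.Theory.
Set Implicit Arguments.
Unset Strict Implicit.
Unset Printing Implicit Defensive.
Local Open Scope ring_scope.

(** * Orthogonal maps between families with equal Gram matrices *)

Section OrthogonalExtension.
Variable R : realFieldType.

Definition dotv (d : nat) (u v : 'rV[R]_d) : R := (u *m v^T) 0 0.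

Lemma dotvC d (u v : 'rV[R]_d) : dotv u v = dotv v u.
Proof.
by rewrite /dotv -[u *m v^T]trmxK trmx_mul trmxK mxE.
Qed.

Lemma dotvBl d (u v w : 'rV[R]_d) : dotv (u - v) w = dotv u w - dotv v w.
Proof. by rewrite /dotv mulmxBl !mxE. Qed.

Lemma dotvBr d (u v w : 'rV[R]_d) : dotv w (u - v) = dotv w u - dotv w v.
Proof. by rewrite dotvC dotvBl !(dotvC w). Qed.

Lemma dotv_eq0 d (u : 'rV[R]_d) : (dotv u u == 0) = (u == 0).
Proof.
apply/eqP/eqP => [|->]; last by rewrite /dotv mul0mx mxE.
rewrite /dotv mxE => /eqP; rewrite psumr_eq0; last first.
  by move=> i _; rewrite mxE -expr2 sqr_ge0.
move=> /allP u0; apply/rowP => i; apply/eqP.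
have := u0 i (mem_index_enum i).
by rewrite /= !mxE mulf_eq0 orbb.
Qed.

(** For [w = 0] the coefficient [2 / dotv w w] is [0] by the convention on inverses, and the
    reflection is the identity. *)
Definition householder d (w : 'rV[R]_d) : 'M[R]_d :=
  1%:M - (2 / dotv w w) *: (w^T *m w).

Lemma mul_householder d (u w : 'rV[R]_d) :
  u *m householder w = u - (2 * dotv u w / dotv w w) *: w.
Proof.
rewrite /householder mulmxBr mulmx1 -scalemxAr mulmxA.
rewrite [u *m w^T]mx11_scalar mul_scalar_mx scalerA; congr (_ - _ *: _).
by rewrite /dotv mulrAC.
Qed.

Lemma householderT d (w : 'rV[R]_d) : (householder w)^T = householder w.
Proof. by rewrite /householder linearB linearZ /= tr_scalar_mx trmx_mul trmxK. Qed.

Lemma householder_orthogonal d (w : 'rV[R]_d) :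
  householder w *m (householder w)^T = 1%:M.
Proof.
rewrite householderT; have [->|w0] := eqVneq w 0.
  by rewrite /householder mulmx0 scaler0 subr0 mulmx1.
apply/row_matrixP => i; rewrite row_mul -[row i 1%:M]mul1mx.
rewrite [row i (householder w)]rowE mul_householder.
rewrite mul_householder mul1mx dotvBl row1.
have dw : dotv w w != 0 by rewrite dotv_eq0.
have -> : dotv ((2 * dotv (delta_mx 0 i) w / dotv w w) *: w) w =
          2 * dotv (delta_mx 0 i) w.
  by rewrite /dotv -scalemxAl mxE -/(dotv _ _) mulfVK.
set a := dotv _ w; rewrite -addrA -opprD -scalerDl.
have -> : 2 * a / dotv w w + 2 * (a - 2 * a) / dotv w w = 0 by ring.
by rewrite scale0r subr0.
Qed.

(* Induction on the family: a Householder reflection corrects one more vector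
   and fixes the vectors already matched, which are orthogonal to its axis. *)
Lemma orthogonal_extension (X : eqType) d (f g : X -> 'rV[R]_d) (s : seq X) :
  (forall x y, dotv (f x) (f y) = dotv (g x) (g y)) ->
  exists Q : 'M[R]_d, Q *m Q^T = 1%:M /\ forall x, x \in s -> f x *m Q = g x.
Proof.
move=> fg; elim: s => [|x s [Q [Qo Qs]]]; first by exists 1%:M; rewrite trmx1 mulmx1.
have dQ u v : dotv (u *m Q) (v *m Q) = dotv u v.
  by rewrite /dotv trmx_mul -mulmxA (mulmxA Q) Qo mul1mx.
set w := f x *m Q - g x.
exists (Q *m householder w); split.
  by rewrite trmx_mul -mulmxA (mulmxA (householder w)) householder_orthogonal mul1mx.
move=> y; rewrite inE mulmxA => /orP[/eqP ->|ys].
  have [w0|w0] := eqVneq w 0.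
    by rewrite w0 /householder mulmx0 scaler0 subr0 mulmx1; apply/eqP; rewrite -subr_eq0 -/w w0.
  rewrite mul_householder.
  (* [f x *m Q] and [g x] have the same norm, so the reflection along their difference exchanges
     them. *)
  have dw : dotv w w = 2 * dotv (f x *m Q) w.
    by rewrite /w !dotvBl !dotvBr dQ fg (dotvC (g x) (f x *m Q)); ring.
  by rewrite -dw mulfV ?dotv_eq0// scale1r /w opprB addrC subrK.
rewrite Qs// mul_householder.
suff -> : dotv (g y) w = 0 by rewrite mulr0 mul0r scale0r subr0.
by rewrite dotvBr -{1}(Qs _ ys) dQ fg subrr.
Qed.

End OrthogonalExtension.

(** * From Gram matrices to unitaries and runs of an algorithm *)

Section Simulation.

Definition normsq (B : finType) (v : B -> RR) : RR := \sum_b v b ^+ 2.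

Definition rapply (B : finType) (V : B -> B -> RR) (v : B -> RR) : B -> RR :=
  fun b => \sum_b' V b b' * v b'.

Definition cmat (B : finType) (V : B -> B -> RR) : mat B := fun b b' => (V b b')%:C%C.

Lemma mapply_cmat (B : finType) (V : B -> B -> RR) (v : B -> RR) :
  mapply (cmat V) (fun b => (v b)%:C%C) = fun b => (rapply V v b)%:C%C.
Proof.
apply/funext => b; rewrite /mapply /rapply /cmat rmorph_sum /=.
by apply: eq_bigr => b' _; rewrite rmorphM.
Qed.

Lemma cconj_real (a : RR) : cconj a%:C%C = a%:C%C.
Proof. by rewrite /cconj /= oppr0. Qed.

(** Numbering [B] turns functions into row vectors, and [X] is finite, so [orthogonal_extension]
    covers the whole family. Its matrix acts from the right, whence the transposition in [V]. *)
Lemma unitary_of_gram (B X : finType) (f g : X -> B -> RR) :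
  (forall x y, \sum_b f x b * f y b = \sum_b g x b * g y b) ->
  exists V : B -> B -> RR,
    [/\ unitary (cmat V), forall v, normsq (rapply V v) = normsq v
      & forall x, rapply V (f x) = g x].
Proof.
move=> fg; pose rv (v : B -> RR) : 'rV[RR]_#|B| := \row_i v (enum_val i).
have dv u v : dotv (rv u) (rv v) = \sum_b u b * v b.
  rewrite /dotv mxE (reindex_onto enum_rank enum_val) /=; last by move=> i _; rewrite enum_valK.
  rewrite (eq_bigl xpredT) => [|b]; last by rewrite enum_rankK eqxx.
  by apply: eq_bigr => b _; rewrite !mxE enum_rankK.
have [|Q [Qo Qs]] := @orthogonal_extension _ X _ (fun x => rv (f x)) (fun x => rv (g x)) (enum X).
  by move=> x y; rewrite !dv.
pose V b b' := Q (enum_rank b') (enum_rank b).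
have rV v : rv (rapply V v) = rv v *m Q.
  apply/rowP => i; rewrite !mxE /rapply (reindex_onto enum_val enum_rank) /=; last first.
    by move=> b _; rewrite enum_rankK.
  rewrite (eq_bigl xpredT) => [|j]; last by rewrite enum_valK eqxx.
  by apply: eq_bigr => j _; rewrite !mxE /V !enum_valK mulrC.
have nV v : normsq (rapply V v) = normsq v.
  have ns u : normsq u = dotv (rv u) (rv u) by rewrite dv; apply: eq_bigr => b _; rewrite expr2.
  by rewrite !ns rV /dotv trmx_mul -mulmxA (mulmxA Q) Qo mul1mx.
exists V; split => //.
- move=> b b'; transitivity ((\sum_c V c b * V c b')%:C%C : Cplx).
    rewrite rmorph_sum; apply: eq_bigr => c _.
    by rewrite /cmat cconj_real -rmorphM.
  have /matrixP/(_ (enum_rank b) (enum_rank b')) := Qo.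
  rewrite !mxE (reindex_onto enum_rank enum_val) /=; last by move=> i _; rewrite enum_valK.
  rewrite (eq_bigl xpredT) => [|c]; last by rewrite enum_rankK eqxx.
  rewrite (inj_eq enum_rank_inj) => Qbb'.
  transitivity (((b == b')%:R : RR)%:C%C); last by case: (b == b').
  by rewrite -Qbb'; congr (_%:C)%C; apply: eq_bigr => c _; rewrite mxE.
- move=> x; apply/funext => b.
  have /rowP/(_ (enum_rank b)) := Qs x (mem_enum _ _).
  by rewrite -rV !mxE enum_rankK.
Qed.

Variables (n m d : nat).
Implicit Types x : input n m.

Lemma query_map_inj x : injective (@query_map n m d x).
Proof.
move=> [[c p] w] [[c' p'] w']; rewrite /query_map => -[<-] pp <-; congr (_, _, _).
have N0 : (0 < #|{: Sigma n m}|)%N by rewrite (leq_trans _ (ltn_ord p)).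
have := congr1 val pp; rewrite /= !insubdK; try by rewrite -topredE /= ltn_mod.
move=> /eqP; rewrite eqn_modDr !modn_small// => /eqP; exact: val_inj.
Qed.

Definition roracle x (b' b : basis n m d) : RR := (b' == query_map x b)%:R.

Lemma roracleE x v b : rapply (roracle x) v (query_map x b) = v b.
Proof.
rewrite /rapply (bigD1 b)//= /roracle eqxx mul1r big1 ?addr0// => b' b'b.
by rewrite (inj_eq (@query_map_inj x)) eq_sym (negbTE b'b) mul0r.
Qed.

Lemma normsq_roracle x v : normsq (rapply (roracle x) v) = normsq v.
Proof.
rewrite /normsq (reindex_inj (@query_map_inj x)).
by apply: eq_bigr => b _; rewrite roracleE.
Qed.

Lemma rapplyB (B : finType) V (u v : B -> RR) :
  rapply V (fun b => u b - v b) = fun b => rapply V u b - rapply V v b.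
Proof.
by apply/funext => b; rewrite /rapply -sumrB; apply: eq_bigr => b' _; rewrite mulrBr.
Qed.

Lemma cmat_roracle x : cmat (roracle x) = oracle x.
Proof.
apply/funext => b; apply/funext => b'; rewrite /cmat /oracle /roracle.
by case: (_ == _).
Qed.

Lemma sqnorm_real (a : RR) : sqnorm a%:C%C = a ^+ 2.
Proof. by rewrite /sqnorm /= expr0n addr0. Qed.

(* The states phi t x are an idealised run: it is exact between time 0 and time T,
   and only its initial state depends on x, so the true run stays at constant distance. *)
Lemma simulate (T : nat) (phi phi' : nat -> input n m -> basis n m d -> RR)
    (s : basis n m d -> RR) (b0 : basis n m d) (h : input n m -> bool)
    (out : basis n m d -> bool) (e : RR) :
  normsq s = 1 ->
  (forall t x b, phi' t x (query_map x b) = phi t x b) ->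
  (forall t x y, (t < T)%N ->
     \sum_b phi' t x b * phi' t y b = \sum_b phi t.+1 x b * phi t.+1 y b) ->
  (forall x, normsq (fun b => s b - phi 0%N x b) <= e) ->
  (forall x, \sum_(b | out b != h x) phi T x b ^+ 2 <= e) ->
  exists U : nat -> mat (basis n m d),
    (forall i, unitary (U i)) /\
    forall x, 1 - 4 * e <= prob_out (qstate x U b0 T) out (h x).
Proof.
move=> s1 query gram e0 eT.
have ket1 : normsq (fun b => (b == b0)%:R : RR) = 1.
  rewrite /normsq (bigD1 b0)//= eqxx expr1n big1 ?addr0// => b /negbTE ->.
  by rewrite expr0n.
have [|V0 [V0u V0n V0s]] :=
    @unitary_of_gram _ unit (fun _ b => (b == b0)%:R : RR) (fun _ => s).
  move=> _ _; rewrite -[RHS]/(\sum_b s b * s b).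
  transitivity (normsq (fun b => (b == b0)%:R : RR)).
    by apply: eq_bigr => b _; rewrite expr2.
  by rewrite ket1 -s1; apply: eq_bigr => b _; rewrite expr2.
have /choice[V Vp] : forall t, exists V : basis n m d -> basis n m d -> RR,
    [/\ unitary (cmat V), forall v, normsq (rapply V v) = normsq v
      & forall x, (t < T)%N -> rapply V (phi' t x) = phi t.+1 x].
  move=> t; case: (ltnP t T) => tT.
    have [V [Vu Vn Vs]] := unitary_of_gram (fun x y => gram t x y tT).
    by exists V; split.
  by exists V0; split.
pose W t := if t is t'.+1 then V t' else V0.
pose fix psi x t := if t is t'.+1 then rapply (V t') (rapply (roracle x) (psi x t')) else s.
have psiE x t : qstate x (fun t => cmat (W t)) b0 t = fun b => (psi x t b)%:C%C.
  elim: t => [|t IH] /=.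
    rewrite -(V0s tt) -mapply_cmat; congr mapply.
    by apply/funext => b; rewrite /ket; case: (_ == _).
  by rewrite IH -cmat_roracle !mapply_cmat.
have psin x t : normsq (psi x t) = 1.
  elim: t => [//|t IH] /=; have [_ -> _] := Vp t.
  by rewrite normsq_roracle.
have dist x t : (t <= T)%N -> normsq (fun b => psi x t b - phi t x b) <= e.
  elim: t => [_|t IH tT]; first exact: e0.
  rewrite /=; have [_ Vn <-//] := Vp t.
  have -> : phi' t x = rapply (roracle x) (phi t x).
    apply/funext => b; have [g gK Kg] := injF_bij (@query_map_inj x).
    by rewrite -(Kg b) query roracleE.
  by rewrite -rapplyB Vn -rapplyB normsq_roracle IH// ltnW.
exists (fun t => cmat (W t)); split.
  by case=> [|t]//=; have [] := Vp t.
move=> x; rewrite psiE /prob_out.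
under eq_bigr => b _ do rewrite sqnorm_real.
have := psin x T; rewrite /normsq (bigID (fun b => out b == h x)) /= => tot.
rewrite lerBlDr -[X in X <= _]tot lerD2l.
have {}dist := dist x T (leqnn _); have {}eT := eT x.
have distT : \sum_(b | out b != h x) (psi x T b - phi T x b) ^+ 2 <= e.
  apply: le_trans dist; rewrite /normsq [leRHS](bigID (fun b => out b == h x)) /=.
  by rewrite lerDr sumr_ge0// => b _; rewrite sqr_ge0.
(* From [u^2 <= 2 (u - v)^2 + 2 v^2]: the weight on wrong outputs is at most [2 (e + e)]. *)
apply: (@le_trans _ _ (2 * (\sum_(b | out b != h x) (psi x T b - phi T x b) ^+ 2
   + \sum_(b | out b != h x) phi T x b ^+ 2))); last by lra.
rewrite -big_split mulr_sumr; apply: ler_sum => b _ /=.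
have := sqr_ge0 (psi x T b - phi T x b - phi T x b).
by rewrite -subr_ge0; congr (0 <= _); ring.
Qed.

End Simulation.

(** * The dual adversary program *)

Section AdversaryDual.
Variables (R : realFieldType) (K S : finType).
Implicit Types (A B : {ffun K -> S} -> Prop) (D : {ffun K -> S} -> {ffun K -> S} -> R).

(* Feasible solutions of value W of the dual adversary program, with prescribed right-hand
   side D; D = 1 is the program for distinguishing A from B. *)
Definition adv_dual A B D (W : R) : Prop :=
  exists (I : finType) (c : I -> K) (p q : {ffun K -> S} -> I -> R),
    [/\ forall x, A x -> \sum_i p x i ^+ 2 <= W,
        forall y, B y -> \sum_i q y i ^+ 2 <= W
      & forall x y, A x -> B y ->
          D x y = \sum_i p x i * q y i * (x (c i) != y (c i))%:R].

End AdversaryDual.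

(** * From a dual solution to a query algorithm *)

Section DualToQuery.
Variables (n m : nat) (c0 : cell n m) (I : finType) (cq : I -> cell n m).
Notation N := #|{: Sigma n m}|.

(** [None] stands for |start>, [Some b] for the answer [b], and [inr (i, b)] for the half [b] of
    index [i] in zeta. *)
Definition workspace : finType := (option bool + I * bool)%type.
Notation bas := (basis n m #|{: workspace}|).

Lemma sum_basis (F : bas -> RR) :
  \sum_b F b = \sum_(w : workspace) \sum_c \sum_p F (c, p, enum_rank w).
Proof.
have -> : \sum_b F b = \sum_(b : cell n m * 'I_N) \sum_w F (b, w).
  by rewrite pair_bigA; apply: eq_bigr => -[].
rewrite exchange_big /=.
rewrite (reindex_onto enum_rank enum_val) /=; last by move=> i _; rewrite enum_valK.
rewrite (eq_bigl xpredT) => [|w]; last by rewrite enum_rankK eqxx.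
by apply: eq_bigr => w _; rewrite pair_bigA; apply: eq_bigr => -[].
Qed.

Lemma card_Sigma_gt0 : (0 < N)%N.
Proof. by apply/card_gt0P; exists blank. Qed.

Definition reg0 : 'I_N := Ordinal card_Sigma_gt0.

(** The register content that a query turns into [0]. The modulus matters for rank [0] only, where
    [N - 0] is out of range. *)
Definition reg_opp (s : Sigma n m) : 'I_N :=
  Ordinal (ltn_pmod (N - enum_rank s) card_Sigma_gt0).

Lemma reg_oppK s : (reg_opp s + enum_rank s)%N = 0 %[mod N].
Proof. by rewrite /= modnDml subnK ?modnn ?mod0n// ltnW. Qed.

Lemma reg_opp_inj : injective reg_opp.
Proof.
move=> s s' ss'; apply: enum_rank_inj; apply: val_inj.
have := reg_oppK s; rewrite ss' -(reg_oppK s') => /eqP.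
by rewrite eqn_modDl !modn_small// => /eqP.
Qed.

(* The public registers carry the uniform superposition over p, which queries fix. *)
Definition cat_state (a0 a1 : RR) (h : bool) (r : I * bool -> RR) (g : I * bool -> 'I_N) :
    bas -> RR :=
  fun b => let: (c, p, w) := b in
  match enum_val w with
  | inl None => a0 * (c == c0)%:R / Num.sqrt N%:R
  | inl (Some b) => a1 * (b == h)%:R * (c == c0)%:R / Num.sqrt N%:R
  | inr ib => r ib * (c == cq ib.1)%:R * (p == g ib)%:R
  end.

Lemma sum_option (T : finType) (F : option T -> RR) :
  \sum_o F o = F None + \sum_t F (Some t).
Proof.
rewrite (bigD1 None)//=; congr (_ + _).
rewrite (reindex_omap Some id) => [|[]//].
by apply: eq_bigl => t; rewrite /= eqxx.
Qed.

Lemma sum_delta (T : finType) (a : RR) (t : T) (F : T -> RR) :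
  \sum_u a * (u == t)%:R * F u = a * F t.
Proof.
rewrite (bigD1 t)//= eqxx mulr1 big1 ?addr0// => u /negbTE ->.
by rewrite mulr0 mul0r.
Qed.

Lemma sum_uniform (a : RR) :
  \sum_(c : cell n m) \sum_(p : 'I_N) a * (c == c0)%:R / N%:R = a.
Proof.
have cst (v : RR) : \sum_(p : 'I_N) v = v * N%:R by rewrite sumr_const card_ord mulr_natr.
have N0 : N%:R != 0 :> RR by rewrite pnatr_eq0 -lt0n card_Sigma_gt0.
under eq_bigr => c _ do rewrite cst mulfVK//.
rewrite (bigD1 c0)//= eqxx mulr1 big1 ?addr0// => c /negbTE ->.
by rewrite mulr0.
Qed.

Lemma cat_state_dot a0 a1 h r g b0 b1 h' r' g' :
  \sum_b cat_state a0 a1 h r g b * cat_state b0 b1 h' r' g' b =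
  a0 * b0 + a1 * b1 * (h == h')%:R + \sum_ib r ib * r' ib * (g ib == g' ib)%:R.
Proof.
have V2 : N%:R^-1 = (Num.sqrt N%:R)^-1 * (Num.sqrt N%:R)^-1 :> RR.
  by rewrite -invfM -expr2 sqr_sqrtr.
rewrite sum_basis big_sumType /= sum_option /=; congr (_ + _ + _).
- rewrite -[RHS]sum_uniform; apply: eq_bigr => c _; apply: eq_bigr => p _.
  rewrite /cat_state !enum_rankK; case: (c == c0); rewrite ?mulr0 ?mul0r//.
  by rewrite !mulr1 V2; ring.
- transitivity (\sum_(b : bool) a1 * b1 * (b == h)%:R * (b == h')%:R).
    apply: eq_bigr => b _.
    rewrite -[RHS]sum_uniform; apply: eq_bigr => c _; apply: eq_bigr => p _.
    rewrite /cat_state !enum_rankK; case: (c == c0); rewrite ?mulr0 ?mul0r//.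
    by rewrite !mulr1 V2; ring.
  by rewrite sum_delta.
- apply: eq_bigr => -[i b] _.
  rewrite /cat_state; under eq_bigr => c _ do under eq_bigr => p _ do rewrite enum_rankK /=.
  transitivity (\sum_(c : cell n m)
     (r (i, b) * r' (i, b) * (g (i, b) == g' (i, b))%:R) * (c == cq i)%:R * 1).
    apply: eq_bigr => c _; rewrite mulr1.
    transitivity (\sum_p (r (i, b) * r' (i, b) * (c == cq i)%:R) * (p == g (i, b))%:R
                         * (p == g' (i, b))%:R).
      by apply: eq_bigr => p _; case: (c == _) => /=; ring.
    by rewrite sum_delta; ring.
  by rewrite sum_delta mulr1.
Qed.

(** On the half [true] the query turns [-x_c] into [0], on the half [false] it turns [0] into [x_c].
    The other parts do not depend on [p], so the query fixes them. *)
Lemma cat_state_query a0 a1 h r g g' (x : input n m) b :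
  (forall i b, g (i, b) = if b then reg_opp (x (cq i)) else reg0) ->
  (forall i b, g' (i, b) = if b then reg0 else enum_rank (x (cq i))) ->
  cat_state a0 a1 h r g' (query_map x b) = cat_state a0 a1 h r g b.
Proof.
move=> gE g'E; case: b => [[c p] w] /=; case: (enum_val w) => [[]|[i b]]//=.
have [->|] := eqVneq c (cq i); last by rewrite mulr0 !mul0r.
congr (_ * _%:R); congr nat_of_bool.
rewrite gE g'E; set s := x (cq i); rewrite -!val_eqE /=.
rewrite insubdK; last by rewrite -topredE /= ltn_mod card_Sigma_gt0.
case: b => /=.
  rewrite -[X in _ == X](mod0n N) -(reg_oppK s) eqn_modDr /= modn_mod.
  by rewrite (modn_small (ltn_ord p)).
have := ltn_ord (enum_rank s); move: (nat_of_ord (enum_rank s)) => e eN.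
by rewrite -{2}(modn_small eN) -{2}[e]add0n eqn_modDr mod0n modn_small.
Qed.

End DualToQuery.

(** The run has error [4 * (W / T)], which [40 * W <= T] brings down to [1 / 10]. *)
Lemma adv_dual_computes n m (c0 : cell n m) (P : input n m -> Prop) (W : RR) (T : nat) :
  adv_dual P (fun y => ~ P y) (fun _ _ => 1) W ->
  (0 < T)%N -> 40 * W <= T%:R -> computes_with P T.
Proof.
move=> [I [cq [p [q [pW qW pq]]]]] T0 WT.
pose h (x : input n m) := `[< P x >].
have T0R : 0 < T%:R :> RR by rewrite ltr0n.
(* The sign makes the two halves of an index contribute oppositely to the product of a positive and
   a negative state, and equally to the other products. *)
pose r (x : input n m) (ib : I * bool) : RR :=
  (if h x then p x ib.1 else if ib.2 then - q x ib.1 else q x ib.1) / Num.sqrt (2 * T%:R).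
pose g (x : input n m) (ib : I * bool) :=
  if ib.2 then reg_opp (x (cq ib.1)) else reg0 n m.
pose g' (x : input n m) (ib : I * bool) :=
  if ib.2 then reg0 n m else enum_rank (x (cq ib.1)).
pose al t : RR := Num.sqrt ((T - t)%:R / T%:R).
pose be t : RR := Num.sqrt (t%:R / T%:R).
have TT : T%:R / T%:R = 1 :> RR by rewrite divff// gt_eqF.
have al0 : al 0%N = 1 by rewrite /al subn0 TT sqrtr1.
have be0 : be 0%N = 0 by rewrite /be mul0r sqrtr0.
have alT : al T = 0 by rewrite /al subnn mul0r sqrtr0.
have beT : be T = 1 by rewrite /be TT sqrtr1.
have al2 t : al t * al t = (T - t)%:R / T%:R.
  by rewrite -expr2 sqr_sqrtr// divr_ge0.
have be2 t : be t * be t = t%:R / T%:R.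
  by rewrite -expr2 sqr_sqrtr// divr_ge0.
have rr (u v : RR) : u / Num.sqrt (2 * T%:R) * (v / Num.sqrt (2 * T%:R)) = u * v / (2 * T%:R).
  by rewrite mulrACA -invfM -expr2 sqr_sqrtr// mulr_ge0.
have sum_ib (F : I * bool -> RR) : \sum_ib F ib = \sum_i (F (i, true) + F (i, false)).
  transitivity (\sum_i \sum_b F (i, b)); first by rewrite pair_bigA; apply: eq_bigr => -[].
  by apply: eq_bigr => i _; rewrite big_bool.
have rW x : \sum_ib r x ib * r x ib <= W / T%:R.
  have -> : \sum_ib r x ib * r x ib =
      (\sum_i (if h x then p x i else q x i) ^+ 2) / T%:R.
    rewrite sum_ib mulr_suml; apply: eq_bigr => i _; rewrite /r /= !rr.
    by case: (h x); field; rewrite gt_eqF.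
  rewrite ler_pM2r ?invr_gt0//; rewrite /h; case: asboolP => Px; first exact: pW.
  exact: qW.
pose phi t x := cat_state c0 cq (al t) (be t) (h x) (r x) (g x).
pose phi' t x := cat_state c0 cq (al t) (be t) (h x) (r x) (g' x).
pose s := cat_state c0 cq 1 0 true (fun=> 0) (fun=> reg0 n m).
(* Everything but the answer [true] is read as [false]; at time [T] only the zeta part can then be
   wrong. *)
pose out (b : basis n m #|{: workspace I}|) := enum_val b.2 == inl (Some true).
pose b0 : basis n m #|{: workspace I}| := (c0, reg0 n m, enum_rank (inl None : workspace I)).
have zeta x : normsq (cat_state c0 cq 0 0 (h x) (r x) (g x)) <= W / T%:R.
  rewrite /normsq; under eq_bigr => b _ do rewrite expr2.
  rewrite cat_state_dot !mul0r !add0r; apply: le_trans (rW x).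
  by apply: ler_sum => ib _; rewrite eqxx mulr1.
have [|||||U [Uu Us]] :=
  @simulate n m #|{: workspace I}| T phi phi' s b0 h out (W / T%:R).
- rewrite /normsq /s; under eq_bigr => b _ do rewrite expr2.
  rewrite cat_state_dot [X in _ + X]big1 => [|ib _]; last by rewrite !mul0r.
  by rewrite !mul0r mulr1 !addr0.
- by move=> t x b; apply: cat_state_query.
(* From [t] to [t + 1] the start part loses [1 / T], and the answer part gains [1 / T] if the
   answers agree. Before the query only the halves [true] see whether the letters differ, after it
   only the halves [false]; this makes up the balance. *)
- move=> t x y tT; rewrite /phi /phi' !cat_state_dot !al2 !be2.
  rewrite subnS -subn1 !natrB// ?(ltnW tT)// ?subn_gt0// -natr1.
  suff E : \sum_ib r x ib * r y ib * (g' x ib == g' y ib)%:R =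
    \sum_ib r x ib * r y ib * (g x ib == g y ib)%:R - (h x != h y)%:R / T%:R.
    by rewrite E; case: (h x == h y) => /=; field; rewrite gt_eqF.
  have -> : (h x != h y)%:R / T%:R = \sum_i (r x (i, false) * r y (i, false)
     - r x (i, true) * r y (i, true)) * (x (cq i) != y (cq i))%:R.
    transitivity (\sum_i (if h x == h y then 0 else if h x then p x i * q y i else p y i * q x i)
      * (x (cq i) != y (cq i))%:R / T%:R).
      rewrite -mulr_suml; congr (_ / _).
      rewrite /h; case: asboolP => Px; case: asboolP => Py /=.
      - by rewrite big1// => i _; rewrite mul0r.
      - by rewrite -(pq x y Px Py).
      - by under eq_bigr => i _ do rewrite eq_sym; rewrite -(pq y x Py Px).
      - by rewrite big1// => i _; rewrite mul0r.
    apply: eq_bigr => i _; rewrite mulrAC; congr (_ * _).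
    rewrite /r /= !rr.
    by case: (h x); case: (h y) => /=; field; rewrite gt_eqF.
  rewrite !sum_ib -sumrB; apply: eq_bigr => i _; rewrite /g /g' /=.
  rewrite (inj_eq enum_rank_inj) (inj_eq (@reg_opp_inj n m)).
  by case: (x (cq i) == y (cq i)) => /=; ring.
- move=> x; apply: le_trans (zeta x); rewrite /normsq; apply: ler_sum => b _.
  rewrite /s /phi al0 be0; case: b => [[c u] w] /=.
  case: (enum_val w) => [[b|]|ib]; rewrite ?mul0r ?subrr//.
  by rewrite sub0r sqrrN.
- move=> x; apply: le_trans (zeta x).
  rewrite /normsq [leRHS](bigID (fun b => out b != h x)) /=.
  apply: ler_wpDr; first by apply: sumr_ge0 => b _; rewrite sqr_ge0.
  apply: ler_sum => -[[c u] w]; rewrite /out /phi alT beT /=.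
  case: (enum_val w) => [[b|]|ib]//= bh; rewrite ?mul0r//.
  have -> : (b == h x) = false.
    by apply/negbTE; apply: contraNneq bh => <-; case: (b).
  by rewrite mulr0 !mul0r.
have e40 : 4 * (W / T%:R) <= 1 / 10.
  rewrite mulrA ler_pdivrMr//; lra.
exists #|{: workspace I}|, U, b0, out; split => // x; have := Us x; rewrite /h.
by case: asboolP => Px U9; split => // _; apply: le_trans U9; lra.
Qed.

(** * Composition rules for dual solutions *)

Section DualRules.
Variables (R : rcfType) (K S : finType).
Notation X := {ffun K -> S}.
Implicit Types (A B : X -> Prop) (D : X -> X -> R).

Lemma adv_dual_weaken A B D W A' B' D' W' :
  adv_dual A B D W -> (forall x, A' x -> A x) -> (forall y, B' y -> B y) ->
  (forall x y, A' x -> B' y -> D' x y = D x y) -> W <= W' -> adv_dual A' B' D' W'.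
Proof.
move=> [I [c [p [q [pW qW pq]]]]] A'A B'B D'D WW'.
exists I, c, p, q; split.
- by move=> x /A'A/pW/le_trans; apply.
- by move=> y /B'B/qW/le_trans; apply.
- by move=> x y xA yB; rewrite D'D// pq//; [exact: A'A | exact: B'B].
Qed.

Lemma adv_dual0 A B D W :
  (forall x y, A x -> B y -> D x y = 0) -> 0 <= W -> adv_dual A B D W.
Proof.
move=> D0 W0; exists void, (fun v : void => match v with end), (fun _ _ => 0), (fun _ _ => 0).
by split=> [x _|y _|x y xA yB]; rewrite big_pred0 ?D0//; case.
Qed.

Lemma adv_dual_query A B (c : K) : adv_dual A B (fun x y => (x c != y c)%:R : R) 1.
Proof.
exists unit, (fun=> c), (fun _ _ => 1), (fun _ _ => 1).
by split=> *; rewrite big_const card_unit /= ?expr1n ?mulr1 ?mul1r addr0.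
Qed.

Lemma adv_dual_add A B D1 D2 W1 W2 :
  adv_dual A B D1 W1 -> adv_dual A B D2 W2 ->
  adv_dual A B (fun x y => D1 x y + D2 x y) (W1 + W2).
Proof.
move=> [I [c [p [q [pW qW pq]]]]] [I' [c' [p' [q' [pW' qW' pq']]]]].
exists (I + I')%type, (fun i => match i with inl i => c i | inr i => c' i end),
  (fun x i => match i with inl i => p x i | inr i => p' x i end),
  (fun x i => match i with inl i => q x i | inr i => q' x i end).
split=> [x xA|y yB|x y xA yB]; rewrite big_sumType /=.
- by apply: lerD; [exact: pW | exact: pW'].
- by apply: lerD; [exact: qW | exact: qW'].
- by rewrite pq// pq'.
Qed.

(** A direct sum of solutions, block [j] being weighted by [u x j] and [v y j]. Solution [j] is
    evaluated only where its weight is nonzero, hence the form of the conditions on [AJ] and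
    [BJ]. *)
Lemma adv_dual_sum (J : finType) (AJ BJ : J -> X -> Prop) (DJ : J -> X -> X -> R) (W : R)
    A B (u v : X -> J -> R) (a b : R) :
  0 <= W -> 0 < a -> 0 < b ->
  (forall j, adv_dual (AJ j) (BJ j) (DJ j) W) ->
  (forall x j, A x -> u x j != 0 -> AJ j x) ->
  (forall y j, B y -> v y j != 0 -> BJ j y) ->
  (forall x, A x -> \sum_j u x j ^+ 2 <= a) ->
  (forall y, B y -> \sum_j v y j ^+ 2 <= b) ->
  adv_dual A B (fun x y => \sum_j u x j * v y j * DJ j x y) (W * Num.sqrt (a * b)).
Proof.
move=> W0 a0 b0 dJ Au Bv ua vb.
pose T := {I : finType & ((I -> K) * (X -> I -> R) * (X -> I -> R))%type}.
have /choice[F FP] : forall j, exists t : T, let: existT Ij (c, p, q) := t in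
    [/\ forall x, AJ j x -> \sum_(i : Ij) p x i ^+ 2 <= W,
        forall y, BJ j y -> \sum_(i : Ij) q y i ^+ 2 <= W
      & forall x y, AJ j x -> BJ j y ->
          DJ j x y = \sum_(i : Ij) p x i * q y i * (x (c i) != y (c i))%:R].
  by move=> j; have [I [c [p [q H]]]] := dJ j; exists (existT _ I (c, p, q)).
pose I j : finType := projT1 (F j).
pose c j : I j -> K := (projT2 (F j)).1.1.
pose p j : X -> I j -> R := (projT2 (F j)).1.2.
pose q j : X -> I j -> R := (projT2 (F j)).2.
have pW j x : AJ j x -> \sum_i p j x i ^+ 2 <= W.
  rewrite /p /I; have := FP j; case: (F j) => I' [[c' p'] q'] /=.
  by case=> H _ _; exact: H.
have qW j x : BJ j x -> \sum_i q j x i ^+ 2 <= W.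
  rewrite /q /I; have := FP j; case: (F j) => I' [[c' p'] q'] /=.
  by case=> _ H _; exact: H.
have pq j x y : AJ j x -> BJ j y ->
    DJ j x y = \sum_i p j x i * q j y i * (x (c j i) != y (c j i))%:R.
  rewrite /p /q /c /I; have := FP j; case: (F j) => I' [[c' p'] q'] /=.
  by case=> _ _ H; exact: H.
have bW (f : J -> R) (G : forall j, I j -> R) (e : R) : 0 < e ->
    (forall j, f j != 0 -> \sum_i G j i ^+ 2 <= W) -> \sum_j f j ^+ 2 <= e ->
    \sum_j \sum_i (f j * G j i) ^+ 2 <= W * e.
  move=> e0 GW fe; rewrite mulrC; apply: (@le_trans _ _ (\sum_j f j ^+ 2 * W)).
    apply: ler_sum => j _; under eq_bigr => i _ do rewrite exprMn.
    rewrite -mulr_sumr; have [->|fj] := eqVneq (f j) 0; first by rewrite expr0n !mul0r.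
    by rewrite ler_wpM2l ?sqr_ge0// GW.
  by rewrite -mulr_suml ler_wpM2r.
(* lam balances the two sides: lam^2 a = lam^-2 b = sqrt (a b). *)
pose lam := Num.sqrt (Num.sqrt (b / a)).
have ba0 : 0 < b / a by rewrite divr_gt0.
have lam0 : 0 < lam by rewrite !sqrtr_gt0.
have lam2 : lam ^+ 2 = Num.sqrt (b / a) by rewrite sqr_sqrtr// sqrtr_ge0.
have lama : lam ^+ 2 * a = Num.sqrt (a * b).
  rewrite lam2 -{2}(sqr_sqrtr (ltW a0)) expr2 mulrA -sqrtrM ?(ltW ba0)//.
  by rewrite divfK ?gt_eqF// -sqrtrM ?(ltW b0)// mulrC.
have lamb : lam^-1 ^+ 2 * b = Num.sqrt (a * b).
  apply: (mulfI (lt0r_neq0 (exprn_gt0 2 lam0))); rewrite mulrA -exprMn divff ?gt_eqF//.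
  rewrite expr1n mul1r lam2 -sqrtrM ?(ltW ba0)//.
  have -> : b / a * (a * b) = b ^+ 2 by field; rewrite gt_eqF.
  by rewrite sqrtr_sqr ger0_norm// ltW.
exists {j : J & I j}, (fun t => c (tag t) (tagged t)),
  (fun x t => lam * u x (tag t) * p (tag t) x (tagged t)),
  (fun x t => lam^-1 * v x (tag t) * q (tag t) x (tagged t)).
split=> [x xA|y yB|x y xA yB].
- rewrite -(@sig_big_dep _ _ _ _ I xpredT (fun _ => xpredT)
    (fun j i => (lam * u x j * p j x i) ^+ 2)) /=.
  rewrite -lama; apply: bW; first by rewrite mulr_gt0// exprn_gt0.
    by move=> j; rewrite mulf_eq0 negb_or => /andP[_ /(Au _ _ xA)/pW].
  by under eq_bigr => j _ do rewrite exprMn; rewrite -mulr_sumr ler_wpM2l ?sqr_ge0// ua.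
- rewrite -(@sig_big_dep _ _ _ _ I xpredT (fun _ => xpredT)
    (fun j i => (lam^-1 * v y j * q j y i) ^+ 2)) /=.
  rewrite -lamb; apply: bW; first by rewrite mulr_gt0// exprn_gt0// invr_gt0.
    by move=> j; rewrite mulf_eq0 negb_or => /andP[_ /(Bv _ _ yB)/qW].
  by under eq_bigr => j _ do rewrite exprMn; rewrite -mulr_sumr ler_wpM2l ?sqr_ge0// vb.
- rewrite -(@sig_big_dep _ _ _ _ I xpredT (fun _ => xpredT)
    (fun j i => lam * u x j * p j x i * (lam^-1 * v y j * q j y i)
       * (x (c j i) != y (c j i))%:R)) /=.
  apply: eq_bigr => j _.
  have [->|uj] := eqVneq (u x j) 0; first by rewrite !mul0r big1// => i _; rewrite mulr0 !mul0r.
  have [->|vj] := eqVneq (v y j) 0.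
    by rewrite mulr0 !mul0r big1// => i _; rewrite mulr0 mul0r mulr0 mul0r.
  rewrite pq; [|exact: Au|exact: Bv].
  rewrite mulr_sumr; apply: eq_bigr => i _; field; by rewrite gt_eqF.
Qed.

(** Either the letters at [c] differ, or both equal exactly one [s]. Each input enters a single
    branch, so the branches cost their maximum and not their sum. *)
Lemma adv_dual_query_step A B (c : K) (W : R) :
  0 <= W ->
  (forall s, adv_dual (fun x => A x /\ x c = s) (fun y => B y /\ y c = s) (fun _ _ => 1) W) ->
  adv_dual A B (fun _ _ => 1) (1 + W).
Proof.
move=> W0 dW.
have sumd (z : X) : \sum_(s : S) ((z c == s)%:R : R) ^+ 2 <= 1.
  rewrite (bigD1 (z c))//= eqxx expr1n big1 ?addr0// => s /negbTE.
  by rewrite eq_sym => ->; rewrite expr0n.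
have H := @adv_dual_sum _ _ _ _ W A B (fun x s => (x c == s)%:R) (fun y s => (y c == s)%:R)
  1 1 W0 ltr01 ltr01 dW.
rewrite mulr1 sqrtr1 mulr1 in H.
have {}H := H _ _ _ _.
apply: adv_dual_weaken (adv_dual_add (adv_dual_query A B c) (H _ _ _ _)) _ _ _ _ => //.
- by move=> x s Ax; rewrite pnatr_eq0 eqb0 negbK => /eqP.
- by move=> x s Ax; rewrite pnatr_eq0 eqb0 negbK => /eqP.
- move=> x y _ _; under eq_bigr => s _ do rewrite mulr1.
  rewrite (bigD1 (x c))//= eqxx mul1r big1 ?addr0 => [|s /negbTE]; last first.
    by rewrite eq_sym => ->; rewrite mul0r.
  by rewrite eq_sym; case: eqP; rewrite ?addr0 ?add0r.
Qed.

(** A positive input has weight [1] on every [j], a negative one only on one chosen failing [j]. The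
    squared norms [#|J|] and [1] give the square root. *)
Lemma adv_dual_or (J : finType) (AJ BJ : J -> X -> Prop) (W : R) A B :
  0 <= W ->
  (forall j, adv_dual (AJ j) (BJ j) (fun _ _ => 1) W) ->
  (forall x j, A x -> AJ j x) -> (forall y, B y -> exists j, BJ j y) ->
  adv_dual A B (fun _ _ => 1) (W * Num.sqrt #|J|%:R).
Proof.
move=> W0 dJ AA BB.
have [J0|J0] := posnP #|J|.
  apply: adv_dual0; last by rewrite mulr_ge0 ?sqrtr_ge0.
  by move=> x y _ /BB[j _]; have := fintype0 j J0.
have /choice[f fP] : forall y, exists j, B y -> BJ j y.
  move=> y; have [/BB[j]|] := pselect (B y); first by exists j.
  by have /card_gt0P[j _] := J0; exists j.
have JR : 0 < #|J|%:R :> R by rewrite ltr0n.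
have H := @adv_dual_sum _ _ _ _ W A B (fun x s => 1) (fun y s => (f y == s)%:R)
  #|J|%:R 1 W0 JR ltr01 dJ.
rewrite mulr1 in H.
apply: adv_dual_weaken (H _ _ _ _) _ _ _ _ => // {H}.
- by move=> x j Ax _; exact: AA.
- by move=> x j Bx; rewrite pnatr_eq0 eqb0 negbK => /eqP <-; exact: fP.
- by move=> x _; under eq_bigr => j _ do rewrite expr1n; rewrite sumr_const.
- move=> y _; rewrite (bigD1 (f y))//= eqxx expr1n big1 ?addr0// => s /negbTE.
  by rewrite eq_sym => ->; rewrite expr0n.
- move=> x y _ _; under eq_bigr => s _ do rewrite mulr1 mul1r.
  rewrite (bigD1 (f y))//= eqxx big1 ?addr0// => s /negbTE.
  by rewrite eq_sym => ->.
Qed.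

End DualRules.

(** * Following tree paths and internal pointers *)

Section Pointers.
Variables (n m : nat).
Implicit Types (x y : input n m) (c : cell n m).
Local Notation dual A B W := (adv_dual A B (fun _ _ => 1 : RR) W).

Fixpoint depth (t : btree) : nat :=
  if t is Node l r then (maxn (depth l) (depth r)).+1 else 0%N.

Lemma size_leaf_paths t p : p \in leaf_paths t -> (size p <= depth t)%N.
Proof.
elim: t p => [|l IHl r IHr] p /=; first by rewrite inE => /eqP ->.
rewrite mem_cat => /orP[] /mapP[q qt ->] /=; rewrite ltnS leq_max.
  by rewrite IHl.
by rewrite IHr// orbT.
Qed.

Lemma depth_grow t (c : nat) : (depth (grow t c).1 <= (depth t).+1)%N.
Proof.
elim: t c => [|l IHl r IHr] c /=; first by case: c.
have := IHl c; case: (grow l c) => l' c1 /= hl.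
have := IHr c1; case: (grow r c1) => r' c2 /= hr.
by rewrite ltnS -maxnSS geq_max !leq_max hl hr orbT.
Qed.

Lemma depth_complete r : depth (complete r) = r.
Proof. by elim: r => [//|r IH] /=; rewrite IH maxnn. Qed.

(** The leaves need not be counted: beyond the list, [nth] returns the empty path, which satisfies
    the bound too. *)
Lemma size_Tpath (j : 'I_m) : (size (Tpath m j) <= (trunc_log 2 m).+1)%N.
Proof.
rewrite /Tpath; have [js|js] := ltnP j (size (leaf_paths (treeT m))); last first.
  by rewrite nth_default.
apply: leq_trans (size_leaf_paths (mem_nth _ js)) _.
by rewrite /treeT -{3}(depth_complete (trunc_log 2 m)) depth_grow.
Qed.

Definition leads_to x c (p : seq bool) (j : 'I_m) : Prop :=
  exists l : cell n m, follow x c p = Some l /\ l.2 = j /\ Defs.sval (x l) = false.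

Lemma follow_cons x c d p :
  follow x c (d :: p) =
  obind (fun c' => follow x c' p) (if d then rpoint (x c) else lpoint (x c)).
Proof.
rewrite /follow /=; case: (if d then _ else _) => [//|]; by elim: p.
Qed.

(** One query for each pointer, and a last one for the value at the end. *)
Lemma adv_dual_leads_to A B c p j :
  (forall x, A x -> leads_to x c p j) -> (forall y, B y -> ~ leads_to y c p j) ->
  dual A B (size p).+1%:R.
Proof.
elim: p A B c => [|d p IH] A B c HA HB; rewrite -natr1 addrC.
  apply: (adv_dual_query_step (c := c)) => // s; apply: adv_dual0 => // x y [Ax xs] [By ys].
  case: (HB _ By); have [_ [[<-] [cj xc]]] := HA _ Ax.
  by exists c; rewrite ys -xs.
apply: (adv_dual_query_step (c := c)) => // s.
case E: (if d then rpoint s else lpoint s) => [c'|]; last first.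
  apply: adv_dual0 => // x y [/HA[l []]]; rewrite follow_cons => + _ xs.
  by rewrite xs E.
apply: IH (c') _ _ => [x [/HA [l []]]|y [By ys]].
  by rewrite follow_cons => + + xs; rewrite xs E; exists l.
by move=> [l [yl lj]]; apply: (HB _ By); exists l; rewrite follow_cons ys E.
Qed.

(** Letters are recorded along with cells, so inputs with equal traces agree on all cells visited. A
    null pointer ends the trace early. *)
Fixpoint trace x c (r : nat) : seq (cell n m * Sigma n m) :=
  if r is r'.+1 then
    (c, x c) :: (if ipoint (x c) is Some c' then trace x c' r' else [::])
  else [::].

Lemma adv_dual_trace A B c r (W : RR) :
  0 <= W ->
  (forall tr, dual (fun x => A x /\ trace x c r = tr) (fun y => B y /\ trace y c r = tr) W) ->
  dual A B (r%:R + W).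
Proof.
move=> W0; elim: r A B c => [|r IH] A B c H.
  by rewrite add0r; apply: adv_dual_weaken (H [::]) _ _ _ _.
rewrite -natr1 addrAC addrC; apply: (adv_dual_query_step (c := c)); first by rewrite addr_ge0.
move=> s; case E: (ipoint s) => [c'|].
  apply: IH (c') _ => tr; apply: adv_dual_weaken (H ((c, s) :: tr)) _ _ _ _ => //.
    by move=> x /= [[Ax xs] tr']; rewrite xs E tr'.
  by move=> x /= [[Ax xs] tr']; rewrite xs E tr'.
apply: adv_dual_weaken (H [:: (c, s)]) _ _ _ _ => //.
- by move=> x /= [Ax xs]; rewrite xs E.
- by move=> x /= [Ax xs]; rewrite xs E.
- by rewrite lerDr.
Qed.

End Pointers.

(** * The cycle of special elements *)

Section Witness.
Variables (n m k : nat).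
Implicit Types (x y : input n m) (c : cell n m).

Definition h_witness x (b : 'I_k -> 'I_m) (a : 'I_k -> 'I_n) : Prop :=
    injective b /\
    (forall j : 'I_m, marked x j <-> exists s, j = b s) /\
    (forall s : 'I_k, x (a s, b s) <> blank /\
        forall i : 'I_n, i <> a s -> x (i, b s) = blank) /\
    (forall s : 'I_k, ipoint (x (a s, b s)) = Some (a (ordS s), b (ordS s))) /\
    (forall s t : 'I_k, lpoint (x (a s, b s)) = lpoint (x (a t, b t)) /\
                        rpoint (x (a s, b s)) = rpoint (x (a t, b t))) /\
    (forall j : 'I_m, ~ marked x j ->
       forall s : 'I_k, leads_to x (a s, b s) (Tpath m j) j).

Lemma val_iter_ordS (s : 'I_k) i : val (iter i (@ordS k) s) = ((s + i) %% k)%N.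
Proof.
elim: i => [|i IH] /=; first by rewrite addn0 modn_small.
by rewrite IH -addn1 modnDml addn1 addnS.
Qed.

Lemma iter_ordS_onto (s t : 'I_k) : exists2 i, (i < k)%N & t = iter i (@ordS k) s.
Proof.
have k0 : (0 < k)%N by rewrite (leq_trans _ (ltn_ord s)).
exists ((t + (k - s)) %% k)%N; first by rewrite ltn_mod.
apply: val_inj; rewrite val_iter_ordS modnDmr addnCA subnKC ?(ltnW (ltn_ord s))//.
by rewrite modnDr modn_small.
Qed.

Lemma trace_witness x b a s r : h_witness x b a ->
  trace x (a s, b s) r =
  [seq (let t := iter i (@ordS k) s in ((a t, b t), x (a t, b t))) | i <- iota 0 r].
Proof.
move=> [_ [_ [_ [ip _]]]]; elim: r s => [//|r IH] s /=.
rewrite ip IH -[1%N]addn0 iotaDl -map_comp; congr (_ :: _); apply: eq_map => i /=.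
by rewrite -iterSr.
Qed.

(** [k] steps of the cyclic successor exhaust the cycle, so as a set the trace does not depend on
    the starting point. *)
Lemma trace_witness_mem x b a s p : h_witness x b a ->
  p \in trace x (a s, b s) k <-> exists t, p = ((a t, b t), x (a t, b t)).
Proof.
move=> wit; rewrite (trace_witness _ _ wit); split=> [/mapP[i _ ->]|[t ->]].
  by eexists.
have [i ik ->] := iter_ordS_onto s t.
by apply/mapP; exists i; rewrite ?mem_iota.
Qed.

End Witness.

(** * Verification from a given special element *)

Section Verification.
Variables (n m k : nat).
Implicit Types (x y : input n m) (c : cell n m).
Local Notation dual A B W := (adv_dual A B (fun _ _ => 1 : RR) W).

Lemma trace_val x c r p : p \in trace x c r -> p.2 = x p.1.
Proof.
elim: r c => [//|r IH] c /=; rewrite inE => /orP[/eqP -> //|].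
by case: (ipoint (x c)) => [c'|//]; exact: IH.
Qed.

(** The starting cell matters only through its tree pointers, so the paths from one special element
    stand for those from all. *)
Lemma follow_same x c c' p : p != [::] -> lpoint (x c) = lpoint (x c') ->
  rpoint (x c) = rpoint (x c') -> follow x c p = follow x c' p.
Proof. by case: p => // d p _ lc rc; rewrite !follow_cons lc rc. Qed.

Lemma adv_dual_or2 (A B A1 A2 B1 B2 : input n m -> Prop) (W1 W2 : RR) :
  0 <= W1 -> 0 <= W2 -> dual A1 B1 W1 -> dual A2 B2 W2 ->
  (forall x, A x -> A1 x /\ A2 x) -> (forall y, B y -> B1 y \/ B2 y) ->
  dual A B (2 * (W1 + W2)).
Proof.
move=> W10 W20 d1 d2 HA HB.
have W0 : 0 <= W1 + W2 by rewrite addr_ge0.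
apply: (@adv_dual_weaken _ _ _ A B (fun _ _ => 1) ((W1 + W2) * Num.sqrt #|{: bool}|%:R)) => //.
  apply: (@adv_dual_or _ _ _ bool (fun e => if e then A1 else A2)
    (fun e => if e then B1 else B2)) => //.
  - by case; [apply: adv_dual_weaken d1 _ _ _ _|apply: adv_dual_weaken d2 _ _ _ _];
      rewrite ?lerDl ?lerDr.
  - by move=> x [] /HA[].
  - by move=> y /HB[]; [exists true|exists false].
rewrite mulrC ler_wpM2r// card_bool.
rewrite -[leRHS](@ger0_norm RR)// -sqrtr_sqr ler_wsqrtr//; lra.
Qed.

(** Fixing the trace settles the letters of the special elements. What can still fail is an OR of
    two searches: for another nonblank cell in their columns, and for a failing tree path. *)
Lemma adv_dual_verify A B c :
  (forall x, A x -> exists b a s, @h_witness n m k x b a /\ c = (a s, b s)) ->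
  (forall y, B y -> ~ h_pred k n m y) ->
  dual A B (k%:R + 2 * (Num.sqrt (k * n)%:R + (trunc_log 2 m).+2%:R * Num.sqrt m%:R)).
Proof.
move=> HA HB; apply: (adv_dual_trace (c := c)) => [|tr].
  by rewrite mulr_ge0// addr_ge0 ?mulr_ge0 ?sqrtr_ge0.
(* The columns and rows to search come from one positive input [x0] with this trace; if there is
   none, there is nothing to distinguish. *)
have [[x0 [Ax0 tr0]]|none] := pselect (exists x, A x /\ trace x c k = tr); last first.
  apply: adv_dual0 => [x y Ax _|]; first by case: none; exists x.
  by rewrite mulr_ge0// addr_ge0 ?mulr_ge0 ?sqrtr_ge0.
have [b [a [s0 [wit0 cE]]]] := HA _ Ax0.
have trE t : ((a t, b t), x0 (a t, b t)) \in tr.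
  by rewrite -tr0 cE; apply/(trace_witness_mem _ _ wit0); exists t.
have agree z t : trace z c k = tr -> z (a t, b t) = x0 (a t, b t).
  by move=> trz; have := trE t; rewrite -trz => /trace_val.
pose unmarked j := forall s, j <> b s.
have HA1 x : A x /\ trace x c k = tr -> forall s i, i <> a s -> x (i, b s) = blank.
  move=> [/HA[b' [a' [s' [wit c'E]]]] trx] s i ias.
  have := trE s; rewrite -trx {1}c'E => /(trace_witness_mem _ _ wit)[t [at_ bt _]].
  rewrite bt; have [_ [_ [sp _]]] := wit; apply: (sp t).2.
  by rewrite -at_.
have HA2 x : A x /\ trace x c k = tr -> forall j, unmarked j -> leads_to x c (Tpath m j) j.
  move=> [/HA[b' [a' [s' [wit c'E]]]] trx] j uj.
  have [_ [mk [_ [_ [_ path]]]]] := wit.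
  rewrite c'E; apply: path => /mk[t jt].
  (* Equal traces give equal sets of special elements, so every marked column of [x] is some
     [b u]. *)
  have : ((a' t, b' t), x (a' t, b' t)) \in trace x c k.
    by rewrite c'E; apply/(trace_witness_mem _ _ wit); exists t.
  rewrite trx -tr0 cE => /(trace_witness_mem _ _ wit0)[u [_ bu _]].
  by apply: (uj u); rewrite -bu.
apply: (@adv_dual_or2 _ _
  (fun x => forall s i, i <> a s -> x (i, b s) = blank)
  (fun x => forall j, unmarked j -> leads_to x c (Tpath m j) j)
  (fun y => exists s i, i <> a s /\ y (i, b s) <> blank)
  (fun y => exists j, unmarked j /\ ~ leads_to y c (Tpath m j) j)).
- exact: sqrtr_ge0.
- by rewrite mulr_ge0 ?sqrtr_ge0.
- have -> : (k * n)%N = #|{: 'I_k * 'I_n}| by rewrite card_prod !card_ord.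
  rewrite -[Num.sqrt _]mul1r.
  apply: (@adv_dual_or _ _ _ _ (fun si x => si.2 <> a si.1 -> x (si.2, b si.1) = blank)
    (fun si y => si.2 <> a si.1 /\ y (si.2, b si.1) <> blank)) => //.
  + move=> [s i] /=; apply: adv_dual_weaken
      (@adv_dual_query RR _ _ (fun=> True) (fun=> True) (i, b s)) _ _ _ _ => //.
    move=> x y /= Hx [ias /eqP yb]; rewrite (Hx ias) eq_sym.
    by rewrite yb.
  + by move=> x [s i] Hx; exact: Hx.
  + by move=> y [s [i ?]]; exists (s, i).
- have -> : m%:R = #|'I_m|%:R :> RR by rewrite card_ord.
  apply: (@adv_dual_or _ _ _ _ (fun j x => unmarked j -> leads_to x c (Tpath m j) j)
    (fun j y => unmarked j /\ ~ leads_to y c (Tpath m j) j)) => //.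
  + move=> j.
    have [uj|nuj] := pselect (unmarked j); last by apply: adv_dual0 => // x y _ [].
    apply: adv_dual_weaken (@adv_dual_leads_to n m _ _ c (Tpath m j) j
      (fun _ => id) (fun _ => id)) _ _ _ _ => //.
    * by move=> x; exact.
    * by move=> y [].
    * by rewrite ler_nat ltnS size_Tpath.
  + by move=> x j Hx; exact: Hx.
- by move=> x Ax; split; [exact: HA1|exact: HA2].
- move=> y [By try]; apply: contrapT => /not_orP[ny1 ny2]; apply: (HB _ By).
  have y1 s i : i <> a s -> y (i, b s) = blank.
    by move=> ias; apply: contrapT => yi; apply: ny1; exists s, i.
  have y2 j : unmarked j -> leads_to y c (Tpath m j) j.
    by move=> uj; apply: contrapT => yj; apply: ny2; exists j.
  have [bi [mk [sp [ip [lr _]]]]] := wit0.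
  have ay t := agree y t try.
  (* The two tests settle which columns are marked: a successful path ends at a value [false] in its
     own column, and each column [b s] is blank apart from a letter shared with [x0]. *)
  have my j : marked y j <-> exists s, j = b s.
    split=> [mj|[s ->] i].
      apply: contrapT => nj; have uj : unmarked j by move=> s js; apply: nj; exists s.
      have [[i j'] [_ [/= -> yl]]] := y2 j uj.
      by have := mj i; rewrite yl.
    have [->|/eqP/y1 ->//] := eqVneq i (a s).
    by rewrite ay; apply: (mk _).2; exists s.
  exists b, a; split=> //; split=> //; split; last split; last split.
  + by move=> s; rewrite ay; split; [exact: (sp s).1|exact: y1].
  + by move=> s; rewrite ay ip.
  + by move=> s t; rewrite !ay; exact: lr.
  + move=> j nj s.
    have uj : unmarked j by move=> t jt; apply: nj; apply/my; exists t.
    have [l [fl [lj yl]]] := y2 j uj.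
    exists l; split=> //; rewrite -fl cE; apply: follow_same; rewrite ?ay.
    (* An empty path would end at [c] itself, which lies in column [b s0]. *)
    * apply/eqP => p0; move: fl; rewrite p0 cE => -[lE].
      by apply: (uj s0); rewrite -lj -lE.
    * exact: (lr s s0).1.
    * exact: (lr s s0).2.
Qed.

End Verification.

(** * The overlap S0 of marked columns *)

Section MarkedColumns.
Variables (n m k : nat).
Hypotheses (n_gt0 : (0 < n)%N) (m_gt0 : (0 < m)%N) (k_gt0 : (0 < k)%N).
Implicit Types (x y : input n m) (c : cell n m).

Definition marks x : {set 'I_m} := [set j | [forall i, Defs.sval (x (i, j))]].

Lemma marksP x j : reflect (marked x j) (j \in marks x).
Proof. by rewrite inE; apply: (iffP forallP). Qed.

(** On marked columns of a positive input the pick is forced; elsewhere it is one choice among the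
    nonblank cells. *)
Definition nonblank x (j : 'I_m) : option 'I_n := [pick i | x (i, j) != blank].

Lemma witness_marks x b a : @h_witness n m k x b a ->
  #|marks x| = k /\ forall s, nonblank x (b s) = Some (a s).
Proof.
move=> [bi [mk [sp _]]]; split.
  have -> : marks x = b @: 'I_k.
    apply/setP => j; apply/marksP/imsetP => [/mk[s ->]|[s _ ->]]; first by exists s.
    by apply/mk; exists s.
  by rewrite card_imset// card_ord.
move=> s; rewrite /nonblank; case: pickP => [i|/(_ (a s))]; last first.
  by move=> /negbFE/eqP; case: (sp s).
have [->//|/eqP ias] := eqVneq i (a s).
by rewrite (sp s).2// eqxx.
Qed.

(** With [l] marked columns this is [1 / sqrt k] for [l <= k] and [sqrt k / l] beyond. The column
    state then has squared norm [k l / max(k, l)^2 <= 1], and the product with the amplitude of a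
    positive input is [1 / max(k, l)]. *)
Definition amp x : RR := Num.sqrt k%:R / (maxn k #|marks x|)%:R.

Definition col_state x (j : 'I_m) : RR := (j \in marks x)%:R * amp x.

Definition cell_state x c : RR := (Some c.1 == nonblank x c.2)%:R * col_state x c.2.

Lemma card_indicator (T : finType) (E : {set T}) : #|E|%:R = \sum_t (t \in E)%:R :> RR.
Proof. by rewrite -sum1_card natr_sum big_mkcond; apply: eq_bigr => t _; case: (t \in E). Qed.

Lemma sum_cells (F : cell n m -> RR) : \sum_c F c = \sum_j \sum_i F (i, j).
Proof. by rewrite exchange_big /= pair_bigA; apply: eq_bigr => -[]. Qed.

Lemma kR_gt0 : 0 < k%:R :> RR. Proof. by rewrite ltr0n. Qed.

Lemma maxR_gt0 l : 0 < (maxn k l)%:R :> RR.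
Proof. by rewrite ltr0n leq_max k_gt0. Qed.

Lemma amp_mul x y : #|marks x| = k -> amp x * amp y = (maxn k #|marks y|)%:R^-1.
Proof.
move=> xk; rewrite /amp xk maxnn mulrACA -expr2 sqr_sqrtr// mulrA divff ?mul1r//.
by rewrite gt_eqF ?kR_gt0.
Qed.

Lemma sqr_indicator (b : bool) : b%:R ^+ 2 = b%:R :> RR.
Proof. by case: b; rewrite ?expr1n ?expr0n. Qed.

Lemma col_state_norm x : \sum_j col_state x j ^+ 2 <= 1.
Proof.
rewrite /col_state; under eq_bigr => j _ do rewrite exprMn sqr_indicator.
rewrite -mulr_suml -card_indicator /amp exprMn sqr_sqrtr// exprVn mulrA.
rewrite ler_pdivrMr ?exprn_gt0 ?maxR_gt0// mul1r expr2 -!natrM ler_nat.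
by rewrite leq_mul// ?leq_maxl ?leq_maxr.
Qed.

Lemma cell_state_norm x : \sum_c cell_state x c ^+ 2 <= 1.
Proof.
apply: le_trans (col_state_norm x); rewrite sum_cells; apply: ler_sum => j _.
rewrite /cell_state /=; under eq_bigr => i _ do rewrite exprMn sqr_indicator.
rewrite -mulr_suml ler_piMl ?sqr_ge0//; case: (nonblank x j) => [a|]; last first.
  by rewrite big1.
rewrite (bigD1 a)//= eqxx big1 ?addr0// => i /negbTE ia.
by rewrite (inj_eq Some_inj) ia.
Qed.

Local Notation card_k := (fun x => #|marks x| = k).

Lemma unmarked_row : exists w : input n m -> 'I_m -> 'I_n,
  forall x j, j \notin marks x -> Defs.sval (x (w x j, j)) = false.
Proof.
have /choice[w wP] : forall xj : input n m * 'I_m, exists i,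
    xj.2 \notin marks xj.1 -> Defs.sval (xj.1 (i, xj.2)) = false.
  move=> [x j] /=; have [jx|] := boolP (j \in marks x); first by exists (Ordinal n_gt0).
  by rewrite inE negb_forall => /existsP[i /negbTE xi]; exists i.
by exists (fun x j => w (x, j)) => x j; exact: (wP (x, j)).
Qed.

Lemma sval_marks x j i : j \in marks x -> Defs.sval (x (i, j)) = true.
Proof. by move=> /marksP jx; exact: jx. Qed.

(** Weight [1] on all cells in the marked columns of [x], and [1 / k] on one [false] cell in each
    unmarked column of [y]. They meet in one cell for each column of the difference, where the
    letters differ; the squared norms are at most [n k] and [m / k^2]. *)
Lemma adv_dual_few_marks B :
  adv_dual card_k B (fun x y => (#|marks y| <= k)%N%:R * (#|marks x :\: marks y|%:R / k%:R) : RR)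
    (Num.sqrt ((n * m)%:R / k%:R)).
Proof.
have [w wP] := unmarked_row.
have k0 := kR_gt0.
have -> : (n * m)%:R / k%:R = (n * k)%:R * (m%:R / k%:R ^+ 2) :> RR.
  by rewrite !natrM; field; rewrite gt_eqF.
rewrite -[Num.sqrt _]mul1r.
pose u x c : RR := (c.2 \in marks x)%:R.
pose v y c : RR := (c.1 == w y c.2)%:R *
  ((#|marks y| <= k)%N%:R * (c.2 \notin marks y)%:R / k%:R).
apply: adv_dual_weaken (@adv_dual_sum _ _ _ _ (fun _ _ => True) (fun _ _ => True)
  (fun c x y => (x c != y c)%:R) 1 card_k B u v _ _ _ _ _ _ _ _ _ _)
  (fun _ => id) (fun _ => id) _ (lexx _) => //.
- by rewrite ltr0n muln_gt0 n_gt0.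
- by rewrite divr_gt0 ?exprn_gt0// ltr0n.
- by move=> c; exact: adv_dual_query.
- move=> x xk; rewrite sum_cells /u.
  under eq_bigr => j _ do under eq_bigr => i _ do rewrite sqr_indicator /=.
  under eq_bigr => j _ do rewrite sumr_const card_ord.
  by rewrite sumrMnl -card_indicator xk -mulrnA mulnC.
- move=> y yB; rewrite sum_cells /v.
  apply: (@le_trans _ _ (\sum_(j < m) (k%:R ^+ 2)^-1)); last first.
    by rewrite sumr_const card_ord [leRHS]mulr_natl.
  apply: ler_sum => j _; rewrite (bigD1 (w y j))//= eqxx big1 => [|i /negbTE ->]; last first.
    by rewrite mul0r expr0n.
  rewrite addr0 mul1r exprMn exprVn ler_piMl// ?invr_ge0 ?sqr_ge0//.
  by rewrite -natrM -natrX lern1; case: (#|_| <= k)%N; case: (j \notin _).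
- move=> x y xk yB; rewrite sum_cells card_indicator mulr_suml mulr_sumr.
  apply: eq_bigr => j _; rewrite /u /v /=.
  pose F i : RR := (x (i, j) != y (i, j))%:R.
  rewrite (eq_bigr (fun i => ((j \in marks x)%:R *
    ((#|marks y| <= k)%N%:R * (j \notin marks y)%:R / k%:R)) * (i == w y j)%:R * F i)); last first.
    by move=> i _; rewrite /F; ring.
  rewrite sum_delta /F in_setD.
  have [jx|_] := boolP (j \in marks x); last by rewrite andbF !mul0r mulr0.
  have [jy|jy] := boolP (j \in marks y); first by rewrite /= !(mul0r, mulr0).
  rewrite (_ : x _ != y _) /=; first by ring.
  by apply/eqP => /(congr1 (@Defs.sval n m)); rewrite wP// sval_marks.
Qed.

(** The roles are exchanged: [x] has weight [1] on one [false] cell per unmarked column, at most [m]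
    in all, and [y] has weight [1 / l] on the [n l] cells of its [l] marked columns, of squared norm
    [n / l <= n / k]. *)
Lemma adv_dual_many_marks :
  adv_dual card_k (fun _ => True)
    (fun x y => (k < #|marks y|)%N%:R * (#|marks y :\: marks x|%:R / #|marks y|%:R) : RR)
    (Num.sqrt ((n * m)%:R / k%:R)).
Proof.
have [w wP] := unmarked_row.
have k0 := kR_gt0.
have -> : (n * m)%:R / k%:R = m%:R * (n%:R / k%:R) :> RR.
  by rewrite natrM; ring.
rewrite -[Num.sqrt _]mul1r.
pose u x c : RR := (c.1 == w x c.2)%:R * (c.2 \notin marks x)%:R.
pose v y c : RR := (c.2 \in marks y)%:R * ((k < #|marks y|)%N%:R / #|marks y|%:R).
apply: adv_dual_weaken (@adv_dual_sum _ _ _ _ (fun _ _ => True) (fun _ _ => True)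
  (fun c x y => (x c != y c)%:R) 1 card_k (fun _ => True) u v _ _ _ _ _ _ _ _ _ _)
  (fun _ => id) (fun _ => id) _ (lexx _) => //.
- by rewrite ltr0n.
- by rewrite divr_gt0// ltr0n.
- by move=> c; exact: adv_dual_query.
- move=> x xk; rewrite sum_cells /u.
  apply: (@le_trans _ _ (\sum_(j < m) 1)); last by rewrite sumr_const card_ord.
  apply: ler_sum => j _; rewrite (bigD1 (w x j))//= eqxx big1 => [|i /negbTE ->]; last first.
    by rewrite mul0r expr0n.
  by rewrite addr0 mul1r sqr_indicator lern1 leq_b1.
- move=> y yB; rewrite sum_cells /v.
  have [ky|_] := boolP (k < #|marks y|)%N; last first.
    rewrite big1 ?divr_ge0// => j _; rewrite big1// => i _.
    by rewrite mul0r mulr0 expr0n.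
  have y0 : 0 < #|marks y|%:R :> RR by rewrite ltr0n (leq_trans _ ky).
  rewrite mul1r; under eq_bigr => j _ do under eq_bigr => i _ do rewrite exprMn sqr_indicator /=.
  under eq_bigr => j _ do rewrite sumr_const card_ord.
  rewrite sumrMnl -mulr_suml -card_indicator -mulrnAl exprVn.
  rewrite expr2 invfM mulrA mulrnAl mulfV ?gt_eqF// ler_pM2l ?ltr0n//.
  by rewrite lef_pV2 ?posrE// ler_nat ltnW.
- move=> x y xk yB; rewrite sum_cells card_indicator mulr_suml mulr_sumr.
  apply: eq_bigr => j _; rewrite /u /v /=.
  pose F i : RR := (x (i, j) != y (i, j))%:R.
  rewrite (eq_bigr (fun i => ((j \notin marks x)%:R * ((j \in marks y)%:R *
    ((k < #|marks y|)%N%:R / #|marks y|%:R))) * (i == w x j)%:R * F i)); last first.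
    by move=> i _; rewrite /F; ring.
  rewrite sum_delta /F in_setD.
  have [jy|_] := boolP (j \in marks y); last by rewrite andbF !(mul0r, mulr0).
  have [jx|jx] := boolP (j \in marks x); first by rewrite /= !(mul0r, mulr0).
  rewrite (_ : x _ != y _) /=; first by ring.
  by apply/eqP => /(congr1 (@Defs.sval n m)); rewrite wP// sval_marks.
Qed.

(** The overlap is the number of common marked columns over [max(k, l)] with [l = #|marks y|]. Its
    complement thus counts the columns marked in [x] alone if [l <= k], and in [y] alone
    otherwise. *)
Lemma adv_dual_overlap :
  adv_dual card_k (fun _ => True) (fun x y => 1 - \sum_j col_state x j * col_state y j)
    (2 * Num.sqrt ((n * m)%:R / k%:R)).
Proof.
apply: adv_dual_weaken (adv_dual_add (adv_dual_few_marks _) adv_dual_many_marks)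
  (fun _ => id) (fun _ => id) _ _; last by lra.
move=> x y xk _.
have -> : \sum_j col_state x j * col_state y j =
    #|marks x :&: marks y|%:R / (maxn k #|marks y|)%:R.
  rewrite -(amp_mul _ xk) card_indicator mulr_suml; apply: eq_bigr => j _.
  rewrite /col_state in_setI; do 2! case: (j \in _) => /=; rewrite ?(mul0r, mulr0)//.
  by rewrite !mul1r.
have k0 := kR_gt0.
have [yk|ky] := leqP #|marks y| k.
  rewrite mul0r addr0 mul1r.
  have := congr1 (fun l => l%:R : RR) (cardsID (marks y) (marks x)).
  rewrite xk natrD => E; rewrite -{1}(@divff _ (k%:R : RR)) ?gt_eqF//.
  by rewrite -{1}E; field; rewrite gt_eqF.
rewrite mul0r add0r mul1r setIC.
have y0 : 0 < #|marks y|%:R :> RR by rewrite ltr0n (leq_trans _ ky).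
have := congr1 (fun l => l%:R : RR) (cardsID (marks x) (marks y)).
rewrite natrD => E; rewrite -{1}(@divff _ (#|marks y|%:R : RR)) ?gt_eqF//.
by rewrite -{1}E; field; rewrite gt_eqF.
Qed.

End MarkedColumns.

(** * The overlap S1 of special elements, and the sum of all terms *)

Section SpecialElements.
Variables (n m k : nat).
Hypotheses (n_gt0 : (0 < n)%N) (m_gt0 : (0 < m)%N) (k_gt0 : (0 < k)%N).
Implicit Types (x y : input n m) (c : cell n m).

Local Notation unique_in j := (fun x => exists2 a, nonblank x j = Some a &
  forall i, i <> a -> x (i, j) = blank).

Lemma nonblankP x j i : nonblank x j = Some i -> x (i, j) != blank.
Proof. by rewrite /nonblank; case: pickP => // i' + [<-]. Qed.

Lemma nonblankN x j i : nonblank x j = None -> x (i, j) = blank.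
Proof. by rewrite /nonblank; case: pickP => // /(_ i)/negbFE/eqP. Qed.

Lemma sum_nonblank x j (F : 'I_n -> RR) :
  \sum_i (Some i == nonblank x j)%:R * F i = if nonblank x j is Some a then F a else 0.
Proof.
case: (nonblank x j) => [a|]; last by rewrite big1// => i _; rewrite mul0r.
rewrite (bigD1 a)//= eqxx mul1r big1 ?addr0// => i /negbTE ia.
by rewrite (inj_eq Some_inj) ia mul0r.
Qed.

(** If [y] picks a row other than that of [x], then [x] is blank there: [x] has weight on all rows
    but its own, [y] on its pick. If the column of [y] is blank, the row of [x] tells them apart:
    [x] has weight there, [y] on all rows. Each case costs [sqrt n]. *)
Lemma adv_dual_nonblank j B :
  adv_dual (unique_in j) B (fun x y => (nonblank x j != nonblank y j)%:R : RR)
    (2 * Num.sqrt n%:R).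
Proof.
pose e x i : RR := (Some i == nonblank x j)%:R.
have esum x : \sum_i e x i ^+ 2 <= 1.
  rewrite /e; under eq_bigr => i _ do rewrite sqr_indicator -[_%:R]mulr1.
  by rewrite (sum_nonblank x j (fun=> 1)); case: (nonblank x j).
have leb (b : bool) : b%:R ^+ 2 <= 1 :> RR by rewrite sqr_indicator lern1 leq_b1.
have sum1 (f : 'I_n -> RR) : (forall i, f i ^+ 2 <= 1) -> \sum_i f i ^+ 2 <= n%:R.
  move=> f1; apply: (@le_trans _ _ (\sum_(i < n) 1)); last by rewrite sumr_const card_ord.
  exact: ler_sum.
have d1 := @adv_dual_sum RR _ _ 'I_n (fun _ _ => True) (fun _ _ => True)
  (fun i x y => (x (i, j) != y (i, j))%:R) 1 (unique_in j) B
  (fun x i => (Some i != nonblank x j)%:R) e n%:R 1 ler01 _ ltr01.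
have d2 := @adv_dual_sum RR _ _ 'I_n (fun _ _ => True) (fun _ _ => True)
  (fun i x y => (x (i, j) != y (i, j))%:R) 1 (unique_in j) B
  e (fun y i => (nonblank y j == None)%:R) 1 n%:R ler01 ltr01 _.
have n0 : 0 < n%:R :> RR by rewrite ltr0n.
apply: adv_dual_weaken (adv_dual_add (d1 _ _ _ _ _ _) (d2 _ _ _ _ _ _))
  (fun _ => id) (fun _ => id) _ _ => //; try by [move=> i; exact: adv_dual_query].
- by move=> x _; exact: sum1.
- by move=> x _; exact: sum1.
- move=> x y [a xa ua] _; rewrite -big_split /=.
  case ya: (nonblank y j) => [i|].
    rewrite (bigD1 i)//= big1 => [|i' i'i]; last first.
      by rewrite /e ya (inj_eq Some_inj) (negbTE i'i) !(mulr0, mul0r) addr0.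
    rewrite /e ya eqxx xa mulr0 mul0r !addr0 mulr1.
    have [_|ia] := eqVneq (Some i) (Some a); first by rewrite mul0r.
    rewrite ua; last by move=> ia'; rewrite ia' eqxx in ia.
    by rewrite eq_sym (nonblankP ya) mul1r.
  rewrite (bigD1 a)//= big1 => [|i' i'a]; last first.
    by rewrite /e ya xa (inj_eq Some_inj) (negbTE i'a) !(mulr0, mul0r) addr0.
  rewrite /e ya xa eqxx !(mulr0, mul0r) add0r !mul1r addr0.
  by rewrite (nonblankN _ ya) (nonblankP xa).
- by rewrite mulr1 !mul1r; lra.
Qed.

Lemma witness_unique x b a s : @h_witness n m k x b a ->
  nonblank x (b s) = Some (a s) /\ forall i, i <> a s -> x (i, b s) = blank.
Proof.
move=> wit; split; first exact: (witness_marks wit).2.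
by have [_ [_ [sp _]]] := wit; exact: (sp s).2.
Qed.

Lemma col_state_neq0 x b a j : @h_witness n m k x b a -> col_state k x j != 0 ->
  exists s, j = b s.
Proof.
move=> [_ [mk _]]; rewrite /col_state => jx; apply/mk/marksP.
by apply: contraNT jx => /negbTE ->; rewrite mul0r.
Qed.

(** Column states have norm at most [1], so weighting by them keeps the cost of a single column. *)
Lemma adv_dual_rows B :
  adv_dual (h_pred k n m) B
    (fun x y => \sum_j col_state k x j * col_state k y j * (nonblank x j != nonblank y j)%:R)
    (2 * Num.sqrt n%:R).
Proof.
have := @adv_dual_sum RR _ _ 'I_m (fun j => unique_in j) (fun _ _ => True)
  (fun j x y => (nonblank x j != nonblank y j)%:R) (2 * Num.sqrt n%:R)
  (h_pred k n m) B (col_state k) (col_state k) 1 1.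
rewrite !mulr1 sqrtr1 mulr1; apply=> //.
- by rewrite mulr_ge0 ?sqrtr_ge0.
- by move=> j; exact: adv_dual_nonblank.
- move=> x j [b [a wit]] /(col_state_neq0 wit)[s ->].
  by have [] := witness_unique s wit; exists (a s).
- by move=> x _; exact: col_state_norm.
- by move=> x _; exact: col_state_norm.
Qed.

(** The cell state of a positive input is supported on its special elements, so wherever it counts,
    [c] is a valid start for the verification. *)
Lemma adv_dual_cells :
  adv_dual (h_pred k n m) (fun y => ~ h_pred k n m y)
    (fun x y => \sum_c cell_state k x c * cell_state k y c * 1)
    (k%:R + 2 * (Num.sqrt (k * n)%:R + (trunc_log 2 m).+2%:R * Num.sqrt m%:R) : RR).
Proof.
set W := (W in adv_dual _ _ _ W).
have := @adv_dual_sum RR _ _ (cell n m)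
  (fun c x => exists b a s, @h_witness n m k x b a /\ c = (a s, b s))
  (fun _ y => ~ h_pred k n m y)
  (fun _ _ _ => 1) W
  (h_pred k n m) (fun y => ~ h_pred k n m y) (cell_state k) (cell_state k) 1 1.
rewrite !mulr1 sqrtr1 mulr1; apply=> //.
- by rewrite /W addr_ge0// mulr_ge0// addr_ge0 ?mulr_ge0 ?sqrtr_ge0.
- by move=> c; exact: (adv_dual_verify (c := c) (fun _ => id) (fun _ => id)).
- move=> x [i j] [b [a wit]]; rewrite /cell_state /= mulf_eq0 negb_or => /andP[xi].
  move=> /(col_state_neq0 wit)[s jE]; exists b, a, s; split=> //.
  move: xi; rewrite jE (witness_unique s wit).1 (inj_eq Some_inj) pnatr_eq0 eqb0 negbK.
  by move=> /eqP ->.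
- by move=> x _; exact: cell_state_norm.
- by move=> x _; exact: cell_state_norm.
Qed.

Lemma adv_dual_h :
  adv_dual (h_pred k n m) (fun y => ~ h_pred k n m y) (fun _ _ => 1 : RR)
    (2 * Num.sqrt ((n * m)%:R / k%:R) + 2 * Num.sqrt n%:R +
     (k%:R + 2 * (Num.sqrt (k * n)%:R + (trunc_log 2 m).+2%:R * Num.sqrt m%:R))).
Proof.
have d1 : adv_dual (h_pred k n m) (fun y => ~ h_pred k n m y)
    (fun x y => 1 - \sum_j col_state k x j * col_state k y j : RR)
    (2 * Num.sqrt ((n * m)%:R / k%:R)).
  apply: adv_dual_weaken (adv_dual_overlap n_gt0 m_gt0 k_gt0) _ _ _ _ => //.
  by move=> x [b [a wit]]; exact: (witness_marks wit).1.
apply: adv_dual_weaken (adv_dual_add (adv_dual_add d1 (adv_dual_rows _)) adv_dual_cells)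
  _ _ _ _ => // x y [b [a wit]] _.
(* S1 is the part of S0 coming from the columns in which both inputs pick the same row. *)
suff -> : \sum_c cell_state k x c * cell_state k y c * 1 = \sum_j (col_state k x j * col_state k y j
    - col_state k x j * col_state k y j * (nonblank x j != nonblank y j)%:R).
  by rewrite sumrB; ring.
rewrite sum_cells; apply: eq_bigr => j _; rewrite /cell_state /=.
under eq_bigr => i _ do rewrite mulr1 -mulrA.
rewrite sum_nonblank.
have [->|/(col_state_neq0 wit)[s ->]] := eqVneq (col_state k x j) 0.
  by rewrite !mul0r subr0; case: (nonblank x j) => // a'; rewrite mul0r.
rewrite (witness_unique s wit).1.
by case: eqP => _ /=; ring.
Qed.

End SpecialElements.

Theorem theorem18 :
  exists (C : RR) (c : nat),
    forall n m k : nat, (0 < n)%N -> (0 < m)%N -> (1 <= k)%N -> (k < m)%N ->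
      exists t : nat,
        Q_le (h_pred k n m) t /\
        (t%:R : RR) <=
          C * ((trunc_log 2 (n * m)).+1)%:R ^+ c *
          (Num.sqrt ((n * m)%:R / k%:R) + Num.sqrt ((k * n)%:R) + k%:R
           + Num.sqrt (m%:R)).
Proof.
(* After the factor [40] and rounding up, each of the four terms has a coefficient of at most [160],
   up to one logarithm from the tree depth. *)
exists 1000, 1%N => n m k n0 m0 k0 km.
have dual := adv_dual_h n0 m0 k0.
set W := (W in adv_dual _ _ _ W) in dual.
pose c0 : cell n m := (Ordinal n0, Ordinal m0).
have W0 : 0 <= 40 * W.
  by rewrite mulr_ge0// !addr_ge0// ?mulr_ge0 ?addr_ge0 ?mulr_ge0 ?sqrtr_ge0.
exists (Num.truncn (40 * W)).+1; split.
  exists (Num.truncn (40 * W)).+1; split=> //.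
  apply: (adv_dual_computes c0 dual) => //.
  by rewrite ltW// truncnS_gt.
have tW : (Num.truncn (40 * W))%:R <= 40 * W by rewrite truncn_le.
rewrite expr1 -natr1; move: tW; rewrite /W.
set L := (trunc_log 2 (n * m)).+1%:R : RR.
have L1 : 1 <= L by rewrite ler1n.
have lm : (trunc_log 2 m).+2%:R <= L + 1.
  rewrite natr1 ler_nat !ltnS leq_trunc_log// leq_pmull//.
(* The term [sqrt n] is absorbed by [sqrt (k n)], and the [1] from rounding by [k]. *)
have nkn : Num.sqrt n%:R <= Num.sqrt (k * n)%:R :> RR.
  by rewrite ler_wsqrtr// ler_nat leq_pmull.
have k1 : 1 <= k%:R :> RR by rewrite ler1n.
move: (sqrtr_ge0 ((n * m)%:R / k%:R : RR)) (sqrtr_ge0 ((k * n)%:R : RR)) (sqrtr_ge0 (m%:R : RR)).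
move: nkn; set a := Num.sqrt (_ / _); set b := Num.sqrt (k * n)%:R; set d := Num.sqrt m%:R.
set e := Num.sqrt n%:R; move=> eb a0 b0 d0 tW.
have lmd : (trunc_log 2 m).+2%:R * d <= 2 * L * d by rewrite ler_wpM2r//; lra.
have S0 : 0 <= a + b + k%:R by lra.
have LS : a + b + k%:R <= L * (a + b + k%:R) by rewrite ler_peMl.
have LdE : 0 <= L * d by rewrite mulr_ge0//; lra.
nra.
Qed.
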